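(* With $T(3,n)=\dfrac{60\,(2n)!}{n!\,(n+3)!}$, $$1+\sum_{n=0}^{\infty}T(3,n+1)\,x^n=\sqrt{x}\sum_{k=6}^{\infty}H_k^{(4)}H_{k-2}^{(3)}H_{k-4}^{(2)}+2G_1+2G_2+G_3+G_5.$$
   Context: Paths use steps $(1,1)$ and $(1,-1)$; the level of a point is its $y$-coordinate. A ballot path is a path starting at $(0,0)$ that never goes below level $0$; its height is the maximum level it reaches. A path with $n$ steps is given weight $x^{n/2}$. Let $G_k^{(j)}$ be the sum of the weights of all ballot paths of height at most $k$ ending at level $j$, and $H_k^{(j)}=G_k^{(j)}-G_{k-1}^{(j)}$ the sum of the weights of ballot paths of height exactly $k$ ending at level $j$. Let $G_k=G_k^{(0)}$, the generating function (weight $x^{\text{semilength}}$) of Dyck paths (ballot paths ending at level $0$) of height at most $k$. *)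

(* Defs.v *)
From HB Require Import structures.
From mathcomp Require Import all_boot all_order all_algebra.
From mathcomp Require Import boolp.

Set Implicit Arguments.
Unset Strict Implicit.
Unset Printing Implicit Defensive.

Import Order.TTheory GRing.Theory Num.Theory.
Local Open Scope ring_scope.

Record fps (R : Type) := Fps { fcoef : nat -> R }.

Section FormalPowerSeries.
Variable R : comNzRingType.
Implicit Types (f g h : fps R) (a b : R).

Lemma fpsP f g : (forall n, fcoef f n = fcoef g n) -> f = g.
Proof.
by case: f => f; case: g => g /= fg; congr Fps; apply/funext.
Qed.

HB.instance Definition _ := gen_eqMixin (fps R).
HB.instance Definition _ := gen_choiceMixin (fps R).

Definition fps_zero : fps R := Fps (fun=> 0).
Definition fps_opp f : fps R := Fps (fun n => - fcoef f n).
Definition fps_add f g : fps R := Fps (fun n => fcoef f n + fcoef g n).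
Definition fps_one : fps R := Fps (fun n => (n == 0%N)%:R).
Definition fps_mul f g : fps R :=
  Fps (fun n => \sum_(i < n.+1) fcoef f i * fcoef g (n - i)).
Definition fps_scale a f : fps R := Fps (fun n => a * fcoef f n).

Fact fps_addA : associative fps_add.
Proof. by move=> f g h; apply: fpsP => n; apply: addrA. Qed.
Fact fps_addC : commutative fps_add.
Proof. by move=> f g; apply: fpsP => n; apply: addrC. Qed.
Fact fps_add0 : left_id fps_zero fps_add.
Proof. by move=> f; apply: fpsP => n; apply: add0r. Qed.
Fact fps_addN : left_inverse fps_zero fps_opp fps_add.
Proof. by move=> f; apply: fpsP => n; apply: addNr. Qed.

HB.instance Definition _ :=
  GRing.isZmodule.Build (fps R) fps_addA fps_addC fps_add0 fps_addN.

Definition fps_trunc m f : {poly R} := \poly_(i < m) fcoef f i.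

Lemma fps_mul_trunc m n f g : (n < m)%N ->
  fcoef (fps_mul f g) n = (fps_trunc m f * fps_trunc m g)`_n.
Proof.
move=> nm; rewrite coefM; apply: eq_bigr => i _.
have im : (i < m)%N by apply: leq_ltn_trans nm; rewrite -ltnS.
by rewrite !coef_poly im (leq_ltn_trans (leq_subr _ _) nm).
Qed.

Fact fps_mulC : commutative fps_mul.
Proof.
by move=> f g; apply: fpsP => n; rewrite !(fps_mul_trunc _ _ (ltnSn n)) mulrC.
Qed.

Fact fps_mulA : associative fps_mul.
Proof.
move=> f g h; apply: fpsP => n.
have E u v w : fcoef (fps_mul (fps_mul u v) w) n
    = (fps_trunc n.+1 u * fps_trunc n.+1 v * fps_trunc n.+1 w)`_n.
  rewrite coefM; apply: eq_bigr => i _.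
  by rewrite (fps_mul_trunc _ _ (ltn_ord i)) coef_poly ltnS leq_subr.
by rewrite fps_mulC !E mulrC mulrA.
Qed.

Fact fps_mul1 : left_id fps_one fps_mul.
Proof.
move=> f; apply: fpsP => n /=; rewrite big_ord_recl /= mul1r subn0 big1 ?addr0//.
by move=> i _; rewrite mul0r.
Qed.

Fact fps_mulDl : left_distributive fps_mul fps_add.
Proof.
move=> f g h; apply: fpsP => n /=; rewrite -big_split /=.
by apply: eq_bigr => i _; rewrite mulrDl.
Qed.

Fact fps_one_neq0 : fps_one != fps_zero.
Proof.
by apply/eqP => /(congr1 (fun f => fcoef f 0)) /= /eqP; rewrite oner_eq0.
Qed.

HB.instance Definition _ := GRing.Zmodule_isComNzRing.Build (fps R)
  fps_mulA fps_mulC fps_mul1 fps_mulDl fps_one_neq0.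

Fact fps_scaleA a b f : fps_scale a (fps_scale b f) = fps_scale (a * b) f.
Proof. by apply: fpsP => n; apply: mulrA. Qed.
Fact fps_scale1 : left_id 1 fps_scale.
Proof. by move=> f; apply: fpsP => n; apply: mul1r. Qed.
Fact fps_scaleDr : right_distributive fps_scale +%R.
Proof. by move=> a f g; apply: fpsP => n; apply: mulrDr. Qed.
Fact fps_scaleDl f : {morph fps_scale^~ f : a b / a + b}.
Proof. by move=> a b; apply: fpsP => n; apply: mulrDl. Qed.

HB.instance Definition _ := GRing.Zmodule_isLmodule.Build R (fps R)
  fps_scaleA fps_scale1 fps_scaleDr fps_scaleDl.

Fact fps_scaleAl a f g : a *: (f * g) = (a *: f) * g.
Proof.
apply: fpsP => n /=; rewrite mulr_sumr.
by apply: eq_bigr => i _; rewrite mulrA.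
Qed.

HB.instance Definition _ :=
  GRing.Lmodule_isLalgebra.Build R (fps R) fps_scaleAl.
HB.instance Definition _ := GRing.Lalgebra_isComAlgebra.Build R (fps R).

Definition fpsX : fps R := Fps (fun n => (n == 1%N)%:R).

                                                                           
                                                                            
                                                
Definition fps_is_sum (m : nat) (F : nat -> fps R) (S : fps R) : Prop :=
  forall n, exists N, forall M, (N <= M)%N ->
    fcoef (\sum_(m <= k < M) F k) n = fcoef S n.

End FormalPowerSeries.

                                                                             
Definition step (b : bool) : int := if b then 1 else -1.
Definition end_level (p : seq bool) : int := \sum_(b <- p) step b.
Definition level (p : seq bool) (i : nat) : int := end_level (take i p).

Definition ballot (p : seq bool) : bool :=
  [forall i : 'I_(size p).+1, 0 <= level p i].

                                                                            
Definition height (p : seq bool) : int :=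
  \big[Num.max/0]_(i < (size p).+1) level p i.

                                                                            
                                                                 
                   
Definition sqrtx : fps rat := fpsX rat.
Definition x : fps rat := sqrtx ^+ 2.

Definition G (k j : nat) : fps rat := Fps (fun n =>
  #|[set p : n.-tuple bool |
      [&& ballot p, height p <= k%:Z & end_level p == j%:Z]]|%:R).

                                                      
Definition H (k j : nat) : fps rat :=
  if k is k'.+1 then G k j - G k' j else G 0 j.

Definition T3 (n : nat) : rat := (60 * (2 * n)`!)%:R / (n`! * (n + 3)`!)%:R.

(* Main.v *)
Require Import Defs.
From mathcomp Require Import all_boot all_order all_algebra.
From mathcomp Require Import ring zify.
Import Order.TTheory GRing.Theory Num.Theory.
Local Open Scope ring_scope.

(** Let c = 1 + x c² be the Catalan series, q = c - 1, y = √x c (so y² = q) and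
    [m] = 1 - q^m.  The linear system expressing the last step of a path is
    solved by G_k^(j) = c y^j [k+1-j] / [k+2], whence
    H_k^(j) = c y^j q^(k-j) [1] [j+1] / ([k+1] [k+2]).  The factors of the
    k-th summand thus combine into
    c² q^(3k-10) [1]³ [3] [4] [5] / ([k-3] ... [k+2]),
    whose denominator is a product of six consecutive q-integers, and the
    q-analogue of Gosper summation telescopes the series.  On the other side,
    T(3,n) = 16 C_n - 8 C_(n+1) + C_(n+2) gives
    ∑ T(3,n+1) x^n = c² (c² - 6c + 10), and what is left is a polynomial
    identity in q. *)

(** * Coefficients, order and cancellation of power series *)

Section Coefficients.
Variable R : comNzRingType.
Implicit Types f g : fps R.

Lemma fcoefD f g n : fcoef (f + g) n = fcoef f n + fcoef g n.
Proof. by []. Qed.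

Lemma fcoefB f g n : fcoef (f - g) n = fcoef f n - fcoef g n.
Proof. by []. Qed.

Lemma fcoefM f g n : fcoef (f * g) n = \sum_(i < n.+1) fcoef f i * fcoef g (n - i).
Proof. by []. Qed.

Lemma fcoefZ a f n : fcoef (a *: f) n = a * fcoef f n.
Proof. by []. Qed.

Lemma fcoef1 n : fcoef (1 : fps R) n = (n == 0%N)%:R.
Proof. by []. Qed.

Lemma fcoefMn f m n : fcoef (f *+ m) n = fcoef f n *+ m.
Proof. by elim: m => // m IH; rewrite !mulrS fcoefD IH. Qed.

Lemma fcoef_sum (I : Type) (r : seq I) (F : I -> fps R) n :
  fcoef (\sum_(i <- r) F i) n = \sum_(i <- r) fcoef (F i) n.
Proof. by elim: r => [|i r IH]; rewrite ?big_nil // !big_cons fcoefD IH. Qed.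

Lemma fcoef0M f g : fcoef (f * g) 0 = fcoef f 0 * fcoef g 0.
Proof. by rewrite fcoefM big_ord1. Qed.

Lemma fcoef0X f n : fcoef (f ^+ n) 0 = fcoef f 0 ^+ n.
Proof. by elim: n => // n IH; rewrite !exprS fcoef0M IH. Qed.

Lemma fcoefXM f n : fcoef (fpsX R * f) n = if n is m.+1 then fcoef f m else 0.
Proof.
case: n => [|n]; first by rewrite fcoef0M mul0r.
rewrite fcoefM big_ord_recl mul0r add0r big_ord_recl mul1r subn1 /= big1 ?addr0 //.
by move=> i _; rewrite mul0r.
Qed.

Lemma fcoefX2M f n :
  fcoef (fpsX R ^+ 2 * f) n = if n is m.+2 then fcoef f m else 0.
Proof. by rewrite expr2 -mulrA fcoefXM; case: n => [|[|n]] //; rewrite fcoefXM. Qed.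

Lemma fcoefX2n m n : fcoef ((fpsX R ^+ 2) ^+ m) n = (n == m.*2)%:R.
Proof.
elim: m n => [|m IH] n; first by rewrite expr0 fcoef1.
by rewrite exprS fcoefX2M; case: n => [|[|n]] //; rewrite IH.
Qed.

Lemma fpsX_inj f g : fpsX R * f = fpsX R * g -> f = g.
Proof.
move=> fg; apply: fpsP => n.
by have := congr1 (fun h => fcoef h n.+1) fg; rewrite !fcoefXM.
Qed.

(** Divisibility by the n-th power of the variable; it measures how close two series are. *)
Definition vanish n f := forall i, (i < n)%N -> fcoef f i = 0.

Lemma vanishM n f g : vanish n f -> vanish n (f * g).
Proof.
move=> vf i lt_in; rewrite fcoefM big1 // => j _.
by rewrite vf ?mul0r // (leq_ltn_trans _ lt_in) // -ltnS.
Qed.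

Lemma vanishXM n f : vanish n f -> vanish n.+1 (fpsX R * f).
Proof. by move=> vf [|i] lt_in; rewrite fcoefXM // vf. Qed.

Lemma vanishXn n : vanish n (fpsX R ^+ n).
Proof. by elim: n => // n IH; rewrite exprS; apply: vanishXM. Qed.

(** Constant coefficient 1 makes each coefficient of [g] equal to that of [f * g] up to multiples of
    earlier ones; no inverse has to be built. *)
Lemma vanish_cancel n f g : fcoef f 0 = 1 -> vanish n (f * g) -> vanish n g.
Proof.
move=> f0 vfg i; elim/ltn_ind: i => i IH lt_in.
have := vfg i lt_in; rewrite fcoefM big_ord_recl subn0 f0 mul1r big1 ?addr0 //.
move=> j _; rewrite IH ?mulr0 //; first by rewrite ltn_subrL (leq_ltn_trans _ (ltn_ord j)).
exact: leq_ltn_trans (leq_subr _ _) lt_in.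
Qed.

Lemma vanish_eq0 f : (forall n, vanish n f) -> f = 0.
Proof. by move=> vf; apply: fpsP => n; apply: (vf n.+1). Qed.

Lemma fps_unit_inj f g h : fcoef f 0 = 1 -> f * g = f * h -> g = h.
Proof.
move=> f0 fgh; apply/subr0_eq/vanish_eq0 => n; apply: (vanish_cancel _ f) => //.
by rewrite mulrBr fgh subrr.
Qed.

Definition euler f : fps R := Fps (fun n => fcoef f n *+ n).

Lemma fcoef_euler f n : fcoef (euler f) n = fcoef f n *+ n.
Proof. by []. Qed.

Lemma eulerM f g : euler (f * g) = euler f * g + f * euler g.
Proof.
apply: fpsP => n; rewrite fcoefD !fcoefM [LHS]/= -sumrMnl -big_split.
apply: eq_bigr => i _ /=; rewrite mulrnAl mulrnAr -mulrnDr subnKC //.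
by rewrite -ltnS.
Qed.

End Coefficients.

(** * Catalan numbers and their generating function *)

Lemma fact_neq0 (F : numDomainType) n : n`!%:R != 0 :> F.
Proof. by rewrite pnatr_eq0 -lt0n fact_gt0. Qed.

Definition catalan_number (F : numFieldType) n : F :=
  (2 * n)`!%:R / (n`! * n.+1`!)%:R.

Lemma catalan_number_rec (F : numFieldType) n :
  (n.+2)%:R * catalan_number F n.+1 = (4 * n + 2)%:R * catalan_number F n.
Proof.
rewrite /catalan_number (_ : 2 * n.+1 = (2 * n).+2)%N; last lia.
rewrite !factS; have := fact_neq0 F n.
move: (n`!) ((2 * n)`!) => a b a0.
have n1 : 1 + n%:R != 0 :> F by rewrite nat1r pnatr_eq0.
have n2 : 2 + n%:R != 0 :> F by rewrite -natrD pnatr_eq0.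
by field; rewrite a0 n1 n2.
Qed.

Lemma super_catalan_number (F : numFieldType) n :
  (60 * (2 * n.+1)`!)%:R / (n.+1`! * (n.+1 + 3)`!)%:R =
  16 * catalan_number F n.+1 - 8 * catalan_number F n.+2 + catalan_number F n.+3.
Proof.
rewrite /catalan_number (_ : 2 * n.+3 = (2 * n.+1).+4)%N; last lia.
rewrite (_ : 2 * n.+2 = (2 * n.+1).+2)%N; last lia.
rewrite addn3 !factS; have := fact_neq0 F n.
move: (n`!) ((2 * n.+1)`!) => a b a0.
have n1 : 1 + n%:R != 0 :> F by rewrite nat1r pnatr_eq0.
have n2 : 2 + n%:R != 0 :> F by rewrite -natrD pnatr_eq0.
have n3 : 3 + n%:R != 0 :> F by rewrite -natrD pnatr_eq0.
have n4 : 4 + n%:R != 0 :> F by rewrite -natrD pnatr_eq0.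
by field; rewrite a0 n1 n2 n3 n4.
Qed.

(** The variable is √x, so the n-th Catalan number sits at index 2n. *)
Definition catalan : fps rat := Fps (fun n => if odd n then 0 else catalan_number rat n./2).

Lemma catalan0 : fcoef catalan 0 = 1.
Proof. by []. Qed.

(** Twice the recurrence of the Catalan numbers, written at n = 2m; for odd n both sides are 0. *)
Lemma catalan_rec n :
  fcoef catalan n.+2 *+ (n + 4) = fcoef catalan n *+ (4 * n.+1).
Proof.
rewrite /= negbK; case: ifP => [|on]; first by rewrite !mul0rn.
have en : n = (n./2 * 2)%N by rewrite muln2 -[LHS]odd_double_half on.
rewrite -[LHS]mulr_natl -[RHS]mulr_natl.
transitivity (2 * ((n./2).+2%:R * catalan_number rat (n./2).+1)).
  by rewrite mulrA -natrM; congr (_%:R * _); lia.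
by rewrite catalan_number_rec mulrA -natrM; congr (_%:R * _); lia.
Qed.

(* With θ the Euler operator in √x, the series s = 1 - 2xc satisfies
   (1 - 4x) θs = -4x s, so the coefficients of s² satisfy a first order
   recurrence, and the one solution with constant coefficient 1 is 1 - 4x. *)
Lemma catalanE : catalan = 1 + x * catalan ^+ 2.
Proof.
pose s := 1 - 2 * (x * catalan).
have s0 : fcoef s 0 = 1.
  by rewrite fcoefB fcoef1 mulr_natl fcoefMn fcoefX2M mul0rn subr0.
have s1 : fcoef s 1 = 0.
  by rewrite fcoefB fcoef1 mulr_natl fcoefMn fcoefX2M mul0rn subr0.
have sS n : fcoef s n.+2 = - 2 * fcoef catalan n.
  by rewrite fcoefB fcoef1 mulr_natl fcoefMn fcoefX2M sub0r mulNr mulr_natl.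
have ode : euler _ s = 4 * (x * (euler _ s - s)).
  apply: fpsP => n; rewrite mulr_natl fcoefMn fcoefX2M.
  case: n => [|[|[|[|n]]]]; rewrite ?(fcoefB _ (euler _ s)) !fcoef_euler ?mulr0n ?mul0rn //.
  - by rewrite s0 sS catalan0.
  - by rewrite s1 sS mulr0 mul0rn subrr mul0rn.
  rewrite !sS.
  have e := catalan_rec n; rewrite -[LHS]mulr_natl -[RHS]mulr_natl in e.
  transitivity (- 2 * ((n + 4)%:R * fcoef catalan n.+2)); first by ring.
  by rewrite e; ring.
have odew : euler _ (s ^+ 2) = 4 * (x * (euler _ (s ^+ 2) - 2 * s ^+ 2)).
  rewrite expr2 eulerM; transitivity (2 * s * euler _ s); first by ring.
  by rewrite {1}ode; ring.
have w n : fcoef (s ^+ 2) n *+ n =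
    if n is m.+2 then 4 * (fcoef (s ^+ 2) m * (m%:R - 2)) else 0.
  rewrite -[LHS]/(fcoef (euler _ (s ^+ 2)) n) odew.
  rewrite mulr_natl fcoefMn fcoefX2M; case: n => [|[|n]]; rewrite ?mul0rn //.
  by rewrite fcoefB fcoef_euler mulr_natl fcoefMn; ring.
have w0 : fcoef (s ^+ 2) 0 = 1 by rewrite fcoef0X s0 expr1n.
have sq : s ^+ 2 = 1 - 4 * x.
  apply: fpsP => n; rewrite -[x]mulr1 fcoefB fcoef1 mulr_natl fcoefMn fcoefX2M.
  move: n; suff E n : fcoef (s ^+ 2) n.+1 = (- 4) *+ (n == 1%N).
    move=> [|[|n]]; rewrite ?E ?w0 ?mul0rn ?subr0 //.
    by rewrite fcoef1 !sub0r -mulr_natl; case: n => //= *; rewrite ?mulr0 ?oppr0.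
  have e (a b : rat) m : a *+ m.+1 = b *+ m.+1 -> a = b.
    by move=> /eqP; rewrite eqr_pMn2r // => /eqP.
  elim/ltn_ind: n => n IH; apply: (e _ _ n); rewrite w.
  case: n IH => [|[|n]] IH; rewrite ?mul0rn //.
    by rewrite w0.
  (* The only nonzero earlier coefficient here is at index 2, where the factor m - 2 of the
     recurrence vanishes. *)
  rewrite IH //; case: n {IH} => [|[|n]]; rewrite ?mulr0n ?mul0r ?mulr0 ?mul0rn //.
(* Multiplied by 4x, the quadratic equation for c becomes s² = 1 - 4x by completing the square. *)
suff: sqrtx * (sqrtx * catalan) = sqrtx * (sqrtx * (1 + x * catalan ^+ 2)).
  by do 2 move/fpsX_inj.
rewrite !mulrA -expr2 -/x.
have {}e (f g : fps rat) : 4 * f = 4 * g -> f = g.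
  move=> fg; apply: fpsP => n; have := congr1 (fun h => fcoef h n) fg.
  by rewrite !mulr_natl !fcoefMn => /eqP; rewrite eqr_pMn2r // => /eqP.
apply/e/subr0_eq; transitivity (1 - 4 * x - s ^+ 2); first by rewrite /s; ring.
by rewrite sq subrr.
Qed.

(** * Paths in a strip and the recurrence on their last step *)

Lemma end_level_rcons p b : end_level (rcons p b) = end_level p + step b.
Proof. by rewrite /end_level big_rcons. Qed.

Lemma level_rcons p b i :
  level (rcons p b) i = if (i <= size p)%N then level p i else end_level (rcons p b).
Proof.
rewrite /level; case: leqP => [le_ip | lt_pi]; first by rewrite -cats1 takel_cat.
by rewrite take_oversize // size_rcons.
Qed.

Definition confined (k : nat) (p : seq bool) := ballot p && (height p <= k%:Z).

(** The default value 0 of the maximum in [height] never exceeds k, so only the bounds on the levels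
    remain. *)
Lemma confinedP k p :
  reflect (forall i, (i <= size p)%N -> 0 <= level p i <= k%:Z) (confined k p).
Proof.
apply: (iffP andP) => [[/forallP b /bigmax_leP[_ h] i le_ip] | b].
  have lt_ip : (i < (size p).+1)%N by [].
  by rewrite (b (Ordinal lt_ip)) (h (Ordinal lt_ip)).
split; first by apply/forallP => i; have /andP[] := b i (ltn_ord i).
by apply/bigmax_leP; split => // i _; have /andP[] := b i (ltn_ord i).
Qed.

Lemma confined_rcons k p b :
  confined k (rcons p b) = confined k p && (0 <= end_level (rcons p b) <= k%:Z).
Proof.
apply/confinedP/andP => [c | [/confinedP c e] i].
  split; last by have := c (size p).+1; rewrite level_rcons ltnn size_rcons; apply.
  apply/confinedP => i le_ip; have := c i; rewrite level_rcons le_ip size_rcons.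
  by apply; rewrite leqW.
by rewrite size_rcons level_rcons; case: (leqP i (size p)) => // le_ip _; apply: c.
Qed.

Lemma confined_end_level k p : confined k p -> 0 <= end_level p <= k%:Z.
Proof.
by move=> /confinedP/(_ (size p) (leqnn _)); rewrite /level take_size.
Qed.

(** An integer end level lets z - 1 leave the strip, where the count is 0. *)
Definition paths k n (z : int) :=
  #|[set p : n.-tuple bool | confined k p & end_level p == z]|.

Lemma fcoefG k j n : fcoef (G k j) n = (paths k n j%:Z)%:R.
Proof.
rewrite /G /paths /=; congr (_%:R); apply: eq_card => p.
by rewrite !inE /confined andbA.
Qed.

Lemma paths_out k n z : ~~ (0 <= z <= k%:Z) -> paths k n z = 0%N.
Proof.
move=> zk; apply/eqP; rewrite cards_eq0; apply/eqP/setP => p; rewrite !inE.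
by apply/negP => /andP[/confined_end_level + /eqP e]; rewrite e (negPf zk).
Qed.

Lemma paths0 k z : paths k 0 z = (z == 0).
Proof.
have conf : confined k [::].
  by apply/confinedP => i; rewrite leqn0 => /eqP ->; rewrite /level /end_level big_nil.
rewrite /paths (_ : [set p | _] = if z == 0 then setT else set0).
  by case: eqP; rewrite ?cards0 // cardsT card_tuple.
apply/setP => p; rewrite tuple0 !inE conf /= /end_level big_nil eq_sym.
by case: eqP; rewrite !inE.
Qed.

Lemma card_tuple_rcons (T : finType) n (P : pred (seq T)) :
  #|[set p : n.+1.-tuple T | P p]| =
  (\sum_(b : T) #|[set p : n.-tuple T | P (rcons p b)]|)%N.
Proof.
pose f (u : T * n.-tuple T) : n.+1.-tuple T := [tuple of rcons u.2 u.1].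
have fbij : bijective f.
  apply: inj_card_bij; last by rewrite card_prod !card_tuple expnS.
  move=> [b p] [b' p'] /(congr1 val) /= /rcons_inj[e ->]; congr pair.
  exact: val_inj.
rewrite cardsE -sum1_card (reindex f) /=; last exact: onW_bij.
rewrite -(pair_big_dep predT (fun b (p : n.-tuple T) => P (rcons p b)) (fun _ _ => 1%N)) /=.
by apply: eq_bigr => b _; rewrite cardsE sum1_card.
Qed.

Lemma paths_rec k n z : 0 <= z <= k%:Z ->
  paths k n.+1 z = (paths k n (z - 1) + paths k n (z + 1))%N.
Proof.
move=> zk; rewrite /paths.
rewrite (card_tuple_rcons _ _ (fun p => confined k p && (end_level p == z))).
have E b e : (0 <= e + step b <= k%:Z) && (e + step b == z) = (e == z - step b).
  by apply/andP/eqP => [[_ /eqP <-]|->]; rewrite ?addrK ?subrK.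
rewrite big_bool -[z + 1]/(z - step false); congr addn; apply: eq_card => p;
  by rewrite !inE confined_rcons end_level_rcons -andbA E.
Qed.

Lemma G_out k j : (k < j)%N -> G k j = 0.
Proof. by move=> kj; apply: fpsP => n; rewrite fcoefG paths_out //; lia. Qed.

Lemma G_rec k j : (j <= k)%N ->
  G k j = (j == 0%N)%:R + sqrtx * ((if j is i.+1 then G k i else 0) + G k j.+1).
Proof.
move=> jk; apply: fpsP => n; rewrite fcoefD fcoefXM fcoefG.
have -> : fcoef ((j == 0%N)%:R : fps rat) n = ((j == 0%N) && (n == 0%N))%:R.
  by case: (j == 0%N).
case: n => [|n]; first by rewrite paths0 andbT addr0.
rewrite paths_rec; last lia.
rewrite andbF add0r fcoefD natrD fcoefG -(natz j.+1) -natr1 natz; congr (_ + _).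
case: j jk => [|j] jk; first by rewrite paths_out.
by rewrite fcoefG; congr (paths _ _ _)%:R; lia.
Qed.

(** Uniqueness for the last-step system: each use of the recurrence gains a factor √x, so every d j
    is divisible by all powers of √x. *)
Lemma band_system_eq0 k (d : nat -> fps rat) : d k.+1 = 0 ->
    (forall j, (j <= k)%N ->
      d j = sqrtx * ((if j is i.+1 then d i else 0) + d j.+1)) ->
  forall j, (j <= k.+1)%N -> d j = 0.
Proof.
move=> dk drec j jk; apply: vanish_eq0 => n; elim: n j jk => // n IH j.
rewrite leq_eqVlt => /predU1P[-> | jk]; first by rewrite dk.
rewrite drec //; apply: vanishXM => i lt_in; rewrite fcoefD IH // addr0.
by case: j jk => // j jk; apply: IH => //; lia.
Qed.

(** * Closed forms for G and H in terms of q *)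

Local Notation c := catalan.
Definition q : fps rat := c - 1.
Definition y : fps rat := sqrtx * c.
Local Notation "[ m ]q" := (1 - q ^+ m) (format "[ m ]q").

Lemma catalan_q : c = 1 + q. Proof. by rewrite /q addrC subrK. Qed.

Lemma sqrtx2_catalan2 : sqrtx ^+ 2 * c ^+ 2 = c - 1.
Proof. by rewrite {2}catalanE addrC addKr. Qed.

Lemma y_sqr : y ^+ 2 = q.
Proof. by rewrite /y exprMn sqrtx2_catalan2. Qed.

(** The difference of the two sides solves the homogeneous system; at j = k + 1 both sides are 0,
    which is the boundary condition. *)
Lemma G_closed k j : (j <= k.+1)%N -> [k.+2]q * G k j = c * y ^+ j * [k.+1 - j]q.
Proof.
move=> jk; apply/subr0_eq.
apply: (band_system_eq0 k (fun j => [k.+2]q * G k j - c * y ^+ j * [k.+1 - j]q)) jk.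
  by rewrite G_out // subnn; ring.
have e := sqrtx2_catalan2.
(* With d = k - j the exponents contain no subtraction, and the recurrence is checked modulo xc² = c
   - 1. *)
move=> {}j jk; rewrite {1}G_rec // subSS subSn //; move: (k - j)%N (subnK jk) => d <- {jk}.
case: j => [|j]; last rewrite (_ : (d + j.+1).+1 - j = d.+2)%N; last lia.
  by rewrite addn0 /= ?subn0 !exprS /q /y; ring: e.
by rewrite /= !exprS /q /y; ring: e.
Qed.

(** Rests on [k+2] [k+2-j] - [k+3] [k+1-j] = q^(k+1-j) [1] [j+1]. *)
Lemma H_closed k j : (j <= k.+1)%N ->
  [k.+2]q * [k.+3]q * H k.+1 j = c * y ^+ j * q ^+ (k.+1 - j) * [1]q * [j.+1]q.
Proof.
move=> jk; rewrite /H.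
transitivity ([k.+2]q * ([k.+3]q * G k.+1 j) - [k.+3]q * ([k.+2]q * G k j)); first by ring.
rewrite !G_closed ?(leqW jk) // (subSn jk) -{1 3}(subnK jk) !exprS exprD; ring.
Qed.

(** * The generating function of T(3,n+1) *)

Definition T3_gf : fps rat := Fps (fun n => if odd n then 0 else T3 (n./2).+1).

Lemma T3_gf_is_sum : fps_is_sum 0 (fun n => T3 n.+1 *: x ^+ n) T3_gf.
Proof.
move=> n; exists n.+1 => M nM; rewrite fcoef_sum.
transitivity (\sum_(0 <= i < M) (if n == i.*2 then T3 i.+1 else 0)).
  by apply: eq_bigr => i _; rewrite fcoefZ fcoefX2n; case: eqP; rewrite ?mulr1 ?mulr0.
rewrite /=; case: ifP => on.
  by rewrite big1 // => i _; case: eqP => // e; rewrite e odd_double in on.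
rewrite (bigD1_seq n./2) ?iota_uniq ?mem_index_iota /=; [|lia|by []].
have -> : n == n./2.*2 by lia.
by rewrite big1 ?addr0 // => i; case: (n =P i.*2) => // ->; rewrite doubleK eqxx.
Qed.

(** By xc² = c - 1, the series c², c²(c + 1) and [g] are the Catalan series shifted by one, two and
    three places; they are combined with weights 16, -8 and 1. *)
Lemma T3_gf_closed : T3_gf = c ^+ 2 * (c ^+ 2 - 6 * c + 10).
Proof.
have shift f g n : x * f = g -> fcoef f n = fcoef g n.+2.
  by move=> <-; rewrite fcoefX2M.
have e : x * c ^+ 2 = c - 1 by rewrite {2}catalanE addrC addKr.
pose g := c ^+ 2 * (c ^+ 2 + 2 * c + 2).
have s1 n : fcoef (c ^+ 2) n = fcoef c n.+2.
  by rewrite (shift _ _ _ e) fcoefB subr0.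
have s2 n : fcoef (c ^+ 2 * (c + 1)) n = fcoef c n.+4.
  rewrite (shift _ (c ^+ 2 - 1)); first by rewrite fcoefB subr0 s1.
  by rewrite mulrA e; ring.
have s3 n : fcoef g n = fcoef c n.+2.+4.
  rewrite (shift _ (c ^+ 2 * (c + 1) - 2)); last by rewrite /g mulrA e; ring.
  by rewrite fcoefB s2 fcoefMn mul0rn subr0.
have -> : c ^+ 2 * (c ^+ 2 - 6 * c + 10) = c ^+ 2 *+ 16 - (c ^+ 2 * (c + 1)) *+ 8 + g.
  by rewrite /g; ring.
apply: fpsP => n; rewrite fcoefD fcoefB !fcoefMn s1 s2 s3 /= !negbK.
case: ifP => _; first by rewrite !mul0rn !subr0 ?addr0.
transitivity (16 * catalan_number rat (n./2).+1 - 8 * catalan_number rat (n./2).+2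
  + catalan_number rat (n./2).+3); last by ring.
by rewrite -super_catalan_number.
Qed.

(** * Telescoping the series *)

Definition summand (k : nat) : fps rat := H k 4 * H (k - 2) 3 * H (k - 4) 2.
(* The value that √x times the series has to take. *)
Definition total : fps rat := 1 + T3_gf - 2 * G 1 0 - 2 * G 2 0 - G 3 0 - G 5 0.

Lemma summand_closed n :
  [n + 3]q * [n + 4]q * [n + 5]q * [n + 6]q * [n + 7]q * [n + 8]q *
    (sqrtx * summand (n + 6)) =
  c ^+ 2 * q ^+ (3 * n + 8) * [1]q ^+ 3 * [3]q * [4]q * [5]q.
Proof.
rewrite (exprD q (3 * n)) (mulnC 3) exprM /summand (_ : n + 6 - 2 = n.+4)%N; last lia.
rewrite (_ : n + 6 - 4 = n.+2)%N; last lia.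
rewrite !addnS !addn0.
have := H_closed n.+1 2; have := H_closed n.+3 3; have := H_closed n.+4.+1 4.
rewrite !subSS !subn0 => h4 h3 h2.
transitivity (sqrtx * ([n.+4.+3]q * [n.+4.+4]q * H n.+4.+2 4)
  * ([n.+4.+1]q * [n.+4.+2]q * H n.+4 3) * ([n.+3]q * [n.+4]q * H n.+2 2)).
  by ring.
rewrite h4 // h3 // h2 //.
(* The levels 4, 3, 2 contribute y^9; the outer √x and one factor c supply the tenth y, and y^10 =
   q^5. *)
transitivity (y ^+ 2 ^+ 5 * c ^+ 2 * (q ^+ n ^+ 3 * q ^+ 3) * [1]q ^+ 3 * [3]q * [4]q * [5]q).
  by rewrite /y !(exprS q); ring.
by rewrite y_sqr; ring.
Qed.

(** Base case of the telescoping: with denominators cleared and c = 1 + q, a polynomial identity in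
    q. *)
Lemma total_closed :
  [3]q * [4]q * [5]q * [6]q * [7]q * total =
  c ^+ 2 * [1]q ^+ 3 * q ^+ 8 * ([4]q * [5]q - q ^+ 6 * [2]q * [5]q + q ^+ 13 * [1]q * [2]q).
Proof.
have := G_closed 1 0; have := G_closed 2 0; have := G_closed 3 0; have := G_closed 5 0.
rewrite expr0 !subn0 => g5 g3 g2 g1.
transitivity ([3]q * [4]q * [5]q * [6]q * [7]q * (1 + T3_gf)
  - 2 * ([4]q * [5]q * [6]q * [7]q) * ([3]q * G 1 0)
  - 2 * ([3]q * [5]q * [6]q * [7]q) * ([4]q * G 2 0)
  - [3]q * [4]q * [6]q * [7]q * ([5]q * G 3 0)
  - [3]q * [4]q * [5]q * [6]q * ([7]q * G 5 0)); first by rewrite /total; ring.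
rewrite g1 // g2 // g3 // g5 // T3_gf_closed catalan_q; move: q => z; ring.
Qed.

(* The right-hand side comes from the ansatz Q³ a(Q), Q = q^(n+3), for the
   numerator of the remainder in q-Gosper summation: a has degree 2. *)
Lemma remainder_closed n :
  [n + 3]q * [n + 4]q * [n + 5]q * [n + 6]q * [n + 7]q *
    (total - sqrtx * \sum_(6 <= k < n + 6) summand k) =
  c ^+ 2 * [1]q ^+ 3 * q ^+ (3 * n + 8) *
    ([4]q * [5]q - q ^+ (n + 6) * [2]q * [5]q + q ^+ (2 * n + 13) * [1]q * [2]q).
Proof.
elim: n => [|n IH].
  by rewrite add0n big_geq // mulr0 subr0 total_closed.
(* Multiplying by [n+3] gives the common denominator [n+3] ... [n+8] of the old remainder and the
   new summand. *)
apply: (fps_unit_inj _ [n + 3]q).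
  by rewrite fcoefB fcoef0X addn3 /= expr0n subr0.
have -> : \sum_(6 <= k < n.+1 + 6) summand k =
    \sum_(6 <= k < n + 6) summand k + summand (n + 6).
  by rewrite (addSn n 6) big_nat_recr //; lia.
rewrite !mulnS !(addSnnS n); set S := \sum_(6 <= k < n + 6) summand k in IH *.
transitivity (
  [n + 8]q * ([n + 3]q * [n + 4]q * [n + 5]q * [n + 6]q * [n + 7]q * (total - sqrtx * S))
  - [n + 3]q * [n + 4]q * [n + 5]q * [n + 6]q * [n + 7]q * [n + 8]q *
    (sqrtx * summand (n + 6))); first by ring.
rewrite IH summand_closed (mulnC 3) (mulnC 2).
by rewrite !exprD !exprM !exprSr; move: q => z; ring.
Qed.

Lemma vanish_remainder n :
  vanish _ n (total - sqrtx * \sum_(6 <= k < n + 6) summand k).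
Proof.
apply: (vanish_cancel _ _ ([n + 3]q * [n + 4]q * [n + 5]q * [n + 6]q * [n + 7]q)).
  by rewrite !fcoef0M !fcoefB !fcoef0X !addnS /= !expr0n subr0 !mulr1.
rewrite remainder_closed.
(* One √x is drawn from each of n factors q = √x (√x c²), enough for order n. *)
have -> : q ^+ (3 * n + 8) = sqrtx ^+ n * ((sqrtx * c ^+ 2) ^+ n * q ^+ (2 * n + 8)).
  rewrite mulrA -exprMn (_ : sqrtx * (sqrtx * c ^+ 2) = q); last by rewrite -y_sqr /y; ring.
  by rewrite -exprD; congr (_ ^+ _); lia.
rewrite [_ * (sqrtx ^+ n * _)]mulrC -!mulrA; apply: vanishM.
exact: vanishXn.
Qed.

Theorem theorem4p2 :
  exists A B : fps rat,
    [/\ fps_is_sum 0 (fun n => T3 n.+1 *: x ^+ n) A,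
        fps_is_sum 6 (fun k => H k 4 * H (k - 2) 3 * H (k - 4) 2) B
      & 1 + A = sqrtx * B + 2%:R * G 1 0 + 2%:R * G 2 0 + G 3 0 + G 5 0].
Proof.
(* The second witness is [total] divided by √x. *)
exists T3_gf, (Fps (fun n => fcoef total n.+1)); split; first exact: T3_gf_is_sum.
  (* Coefficient n of B is coefficient n + 1 of [total], and M >= n + 8 ensures n + 1 < M - 6, the
     order of the remainder. *)
  move=> n; exists (n + 8)%N => M nM.
  have := vanish_remainder (M - 6) n.+1; rewrite subnK; last lia.
  rewrite fcoefB fcoefXM => e; apply/esym/subr0_eq/e; lia.
have -> : sqrtx * Fps (fun n => fcoef total n.+1) = total.
  apply: fpsP => -[|n]; rewrite fcoefXM //.
  (* The constant coefficient of [total] is 0, so the division by √x is exact. *)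
  have := vanish_remainder 1 0%N isT; rewrite fcoefB fcoefXM subr0 => ->; by [].
by rewrite /total; ring.
Qed.
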